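(* Let $(L,\cdot)$ be a commutative associative algebra and let $D$ be a derivation of $(L,\cdot)$. Define $$[x,y]:=x\cdot D(y)-D(x)\cdot y,\quad\forall x,y\in L.$$ Then $(L,\cdot,[\;,\;])$ is a transposed Poisson algebra.
   Context: All vector spaces are over a field $K$ of characteristic zero. Commutative associative algebras are not assumed unital. Derivations are $K$-linear maps $D:L\to L$ with $D(x\cdot y)=D(x)\cdot y+x\cdot D(y)$. A transposed Poisson algebra is a triple $(L,\cdot,[\;,\;])$ where $L$ is a vector space, $\cdot,[\;,\;]:L\otimes L\to L$ are bilinear operations, $(L,\cdot)$ is a commutative associative algebra, $(L,[\;,\;])$ is a Lie algebra, and $2z\cdot[x,y]=[z\cdot x,y]+[x,z\cdot y]$ for all $x,y,z\in L$. *)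

(* Defs.v *)
From HB Require Import structures.
From mathcomp Require Import all_boot all_order all_algebra.

Set Implicit Arguments.
Unset Strict Implicit.
Unset Printing Implicit Defensive.

Import GRing.Theory.
Local Open Scope ring_scope.

(* A K-algebra here is an lmodType together with an explicit binary operation:
   the algebra types of ssralg carry a unit, which is not assumed, and L may be
   infinite-dimensional. *)

(* The Prop-valued form of sesquilinear.bilinear_for *:%R *:%R. *)
Definition is_bilinear (K : fieldType) (L : lmodType K) (op : L -> L -> L)
    : Prop :=
  (forall y, linear (op^~ y)) /\ (forall x, linear (op x)).

Record is_comm_assoc_algebra (K : fieldType) (L : lmodType K)
    (mul : L -> L -> L) : Prop := {
  ca_bilinear : is_bilinear mul;
  ca_commutative : commutative mul;
  ca_associative : associative mul
}.

Record is_lie_algebra (K : fieldType) (L : lmodType K)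
    (br : L -> L -> L) : Prop := {
  lie_bilinear : is_bilinear br;
  lie_alternating : forall x, br x x = 0;
  lie_jacobi : forall x y z,
    br x (br y z) + br y (br z x) + br z (br x y) = 0
}.

Record is_transposed_poisson_algebra (K : fieldType) (L : lmodType K)
    (mul br : L -> L -> L) : Prop := {
  tp_comm_assoc : is_comm_assoc_algebra mul;
  tp_lie : is_lie_algebra br;
  tp_compat : forall x y z,
    2 *: mul z (br x y) = br (mul z x) y + br x (mul z y)
}.

Record is_derivation (K : fieldType) (L : lmodType K)
    (mul : L -> L -> L) (D : L -> L) : Prop := {
  derivation_linear : linear D;
  derivation_leibniz : forall x y, D (mul x y) = mul (D x) y + mul x (D y)
}.

Definition derivation_bracket (K : fieldType) (L : lmodType K)
    (mul : L -> L -> L) (D : L -> L) (x y : L) : L :=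
  mul x (D y) - mul (D x) y.

(* Main.v *)
Require Import Defs.
From mathcomp Require Import all_boot all_order all_algebra.

Set Implicit Arguments.
Unset Strict Implicit.
Unset Printing Implicit Defensive.

Import GRing.Theory.
Local Open Scope ring_scope.

(** Bilinearity and [x, x] = 0 are immediate from the definition of the
    bracket. For the Jacobi identity, the Leibniz rule gives
      [x, [y, z]] = t(x, y, z) - t(z, x, y),
    where t(x, y, z) = x (y D^2 z) + Dx (Dy z), the two terms in Dy Dz having
    cancelled ([derivation_bracket_nested]); hence the sum over the cyclic
    permutations of (x, y, z) telescopes. In the compatibility identity the
    right-hand side is 2 z [x, y] plus the terms -(Dz x) y and x (Dz y), which
    cancel by commutativity and associativity. *)

Section Bilinear.

Variables (K : fieldType) (L : lmodType K) (op : L -> L -> L).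
Hypothesis op_bilinear : is_bilinear op.

Lemma bilinearDl x y z : op (x + y) z = op x z + op y z.
Proof. by have := op_bilinear.1 z 1 x y; rewrite !scale1r. Qed.

Lemma bilinearDr x y z : op x (y + z) = op x y + op x z.
Proof. by have := op_bilinear.2 x 1 y z; rewrite !scale1r. Qed.

Lemma bilinearBr x y z : op x (y - z) = op x y - op x z.
Proof.
have := op_bilinear.2 x (-1) z y; rewrite !scaleN1r.
by rewrite [- z + y]addrC [- op x z + _]addrC.
Qed.

End Bilinear.

Section DerivationBracket.

Variables (K : fieldType) (L : lmodType K) (mul : L -> L -> L) (D : L -> L).
Hypothesis mul_comm_assoc : is_comm_assoc_algebra mul.
Hypothesis D_derivation : is_derivation mul D.

Local Notation "x ** y" := (mul x y) (at level 39, left associativity).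
Local Notation br := (derivation_bracket mul D).

Let mulC : commutative mul := ca_commutative mul_comm_assoc.
Let mulA : associative mul := ca_associative mul_comm_assoc.
Let mulDl := bilinearDl (ca_bilinear mul_comm_assoc).
Let mulDr := bilinearDr (ca_bilinear mul_comm_assoc).
Let mulBr := bilinearBr (ca_bilinear mul_comm_assoc).

Lemma derivationB x y : D (x - y) = D x - D y.
Proof.
have := derivation_linear D_derivation (-1) y x; rewrite !scaleN1r.
by rewrite [- y + x]addrC [- D y + _]addrC.
Qed.

Lemma derivation_bracket_bilinear : is_bilinear br.
Proof.
have [mul_linl mul_linr] := ca_bilinear mul_comm_assoc.
have D_lin := derivation_linear D_derivation.
split=> [y | x] a u v; rewrite /derivation_bracket D_lin !(mul_linl, mul_linr);
  by rewrite scalerBr opprD addrACA.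
Qed.

Lemma derivation_bracket_alternating x : br x x = 0.
Proof. by rewrite /derivation_bracket mulC subrr. Qed.

Lemma derivation_bracket_nested x y z :
  br x (br y z) = (x ** (y ** D (D z)) + D x ** (D y ** z))
                  - (z ** (x ** D (D y)) + D z ** (D x ** y)).
Proof.
rewrite /derivation_bracket derivationB !(derivation_leibniz D_derivation).
have -> : D y ** D z + y ** D (D z) - (D (D y) ** z + D y ** D z)
          = y ** D (D z) - D (D y) ** z.
  by rewrite [D y ** D z + _]addrC opprD addrACA subrr addr0.
have -> : z ** (x ** D (D y)) = x ** (D (D y) ** z) by rewrite mulC mulA.
have -> : D z ** (D x ** y) = D x ** (y ** D z) by rewrite mulC mulA.
by rewrite !mulBr opprB opprD addrACA; congr (_ + _).
Qed.

Lemma derivation_bracket_jacobi x y z :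
  br x (br y z) + br y (br z x) + br z (br x y) = 0.
Proof.
rewrite !derivation_bracket_nested.
set t := _ + D x ** (D y ** z); set u := _ + D z ** (D x ** y).
set v := _ + D y ** (D z ** x).
by rewrite [t - u + _]addrC !subrKA subrr.
Qed.

Lemma derivation_bracket_compat x y z :
  2 *: z ** br x y = br (z ** x) y + br x (z ** y).
Proof.
rewrite /derivation_bracket !(derivation_leibniz D_derivation).
rewrite mulBr mulDl mulDr scaler_nat mulr2n.
have -> : x ** (D z ** y) = D z ** x ** y by rewrite mulA [x ** _]mulC.
have -> : x ** (z ** D y) = z ** (x ** D y) by rewrite mulA [x ** z]mulC -mulA.
have -> : D x ** (z ** y) = z ** (D x ** y) by rewrite mulA [D x ** z]mulC -mulA.
rewrite -!mulA; set A := z ** (x ** D y); set B := z ** (D x ** y).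
set C := D z ** (x ** y).
by rewrite -[C + A - B]addrA opprD [- C - B]addrC [A + (- B - C)]addrA [RHS]addrA subrK.
Qed.

End DerivationBracket.

Theorem proposition2p2 (K : fieldType) (charK : [pchar K] =i pred0)
    (L : lmodType K) (mul : L -> L -> L) (D : L -> L) :
  is_comm_assoc_algebra mul ->
  is_derivation mul D ->
  is_transposed_poisson_algebra mul (derivation_bracket mul D).
Proof.
move=> mulP DP; split=> //; last exact: derivation_bracket_compat.
split; first exact: derivation_bracket_bilinear.
- exact: derivation_bracket_alternating.
- exact: derivation_bracket_jacobi.
Qed.
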